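(* Let $\mathcal{C}$ be a connected, skeletal finite EI category. Then there is a finite free EI category $\hat{\mathcal{C}}$ and a full functor $\hat F:\hat{\mathcal{C}}\to\mathcal{C}$ such that $\hat F$ is the identity map restricted to objects, isomorphisms and unfactorizable morphisms. This finite free EI category $\hat{\mathcal{C}}$ is unique up to isomorphism.
   Context: A finite EI category is a small category with finitely many morphisms in which every endomorphism is an isomorphism. It is skeletal if isomorphic objects are equal, and connected if any two objects are joined by a finite chain of objects in which consecutive ones have a morphism between them in some direction. Composition is from right to left. A morphism $\alpha$ is unfactorizable if it is not an isomorphism and whenever $\alpha=\gamma\beta$, either $\beta$ or $\gamma$ is an isomorphism. ''$\hat F$ is the identity map restricted to objects, isomorphisms and unfactorizable morphisms'' means: $\hat{\mathcal{C}}$ and $\mathcal{C}$ have the same objects, the same automorphism group of each object and, for each pair $x\ne y$, the same biset of unfactorizable morphisms from $x$ to $y$ (unfactorizable in the respective category), and $\hat F$ is the identity on all of these. A finite EI quiver is a datum $\hat Q=(Q_0,Q_1,s,t,f,g)$ where $(Q_0,Q_1,s,t)$ is a finite acyclic quiver, $f$ assigns a finite group $f(v)$ to each vertex $v$, and $g$ assigns an $(f(t(\alpha)),f(s(\alpha)))$-biset to each arrow $\alpha$. It generates a category $\mathcal{C}_{\hat Q}$ with object set $Q_0$, $\mathrm{End}(v)=f(v)$, and, for $v\neq w$, $\mathrm{Hom}(v,w)=\bigsqcup_\gamma H_\gamma$ over all directed paths $\gamma$ from $v$ to $w$, where for $\gamma$ the path $v=v_0\xrightarrow{\alpha_1}v_1\to\cdots\xrightarrow{\alpha_n}v_n=w$,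 $H_\gamma=g(\alpha_n)\times_{f(v_{n-1})}\cdots\times_{f(v_1)}g(\alpha_1)$ (biset product: $X\times_K Y=(X\times Y)/((xk,y)\sim(x,ky))$). Composition is induced by the natural maps $H_{\gamma_2}\times H_{\gamma_1}\to H_{\gamma_2}\times_{f(v)}H_{\gamma_1}=H_{\gamma_2\gamma_1}$ and by the group multiplications and actions. A finite EI category is a finite free EI category if it is isomorphic to some $\mathcal{C}_{\hat Q}$. *)

(* Defs.v *)
From Stdlib Require Import Relations.
From HB Require Import structures.
From mathcomp Require Import all_boot all_fingroup generic_quotient.
From mathcomp Require Import classical_sets functions cardinality.

Set Implicit Arguments.
Unset Strict Implicit.
Unset Printing Implicit Defensive.

Local Open Scope quotient_scope.
Local Open Scope classical_set_scope.

Record category (obj : Type) := Category {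
  hom :> obj -> obj -> Type;
  idm : forall x, hom x x;
  comp : forall x y z, hom y z -> hom x y -> hom x z;
  comp1m : forall x y (f : hom x y), comp (idm y) f = f;
  compm1 : forall x y (f : hom x y), comp f (idm x) = f;
  compA : forall x y z w (h : hom z w) (g : hom y z) (f : hom x y),
    comp h (comp g f) = comp (comp h g) f
}.
Arguments idm {obj} C x : rename.
Arguments comp {obj C x y z} g f : rename.

(* Morphisms with varying end points are compared in this type, which avoids
   transport along equalities of objects. *)
Record mor (obj : Type) (C : category obj) := Mor {
  dom : obj;
  cod : obj;
  arr : C dom cod
}.
Arguments Mor {obj C dom cod} arr.

Definition is_iso (obj : Type) (C : category obj) (x y : obj) (f : C x y) :=
  exists g : C y x, comp g f = idm C x /\ comp f g = idm C y.

Definition unfactorizable (obj : Type) (C : category obj) (x y : obj)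
    (f : C x y) :=
  ~ is_iso f /\
  forall (z : obj) (g : C z y) (b : C x z), f = comp g b -> is_iso b \/ is_iso g.

Definition finite_EI (obj : Type) (C : category obj) :=
  finite_set [set: mor C] /\ forall (x : obj) (f : C x x), is_iso f.

Definition skeletal (obj : Type) (C : category obj) :=
  forall (x y : obj) (f : C x y), is_iso f -> x = y.

Definition connected (obj : Type) (C : category obj) :=
  forall x y : obj,
    clos_refl_trans obj (fun a b => inhabited (C a b) \/ inhabited (C b a)) x y.

Record functor (obj obj' : Type) (C : category obj) (D : category obj') :=
  Functor {
    fobj :> obj -> obj';
    fmap : forall x y, C x y -> D (fobj x) (fobj y);
    fmap1 : forall x, fmap (idm C x) = idm D (fobj x);
    fmapM : forall x y z (g : C y z) (f : C x y),
      fmap (comp g f) = comp (fmap g) (fmap f)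
  }.

Definition fmor (obj obj' : Type) (C : category obj) (D : category obj')
    (F : functor C D) (m : mor C) : mor D := Mor (fmap F (arr m)).

Definition full (obj obj' : Type) (C : category obj) (D : category obj')
    (F : functor C D) :=
  forall (x y : obj) (g : D (F x) (F y)), exists f : C x y, fmap F f = g.

Definition cat_iso (obj obj' : Type) (C : category obj) (D : category obj') :=
  exists (F : functor C D) (G : functor D C),
    [/\ cancel F G, cancel G F,
        cancel (fmor F) (fmor G) & cancel (fmor G) (fmor F)].

(* "F is the identity on objects, isomorphisms and unfactorizable morphisms".
   The hom-sets of C and D are different types, so their isomorphisms (resp.
   their unfactorizable morphisms) are identified along F itself.  As F is a
   functor fixing the objects, this identifies the automorphism groups of each
   object, and the sets of unfactorizable morphisms from x to y as bisets. *)
Definition identity_on_iso_unfact (obj : Type) (C D : category obj)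
    (F : functor C D) :=
  [/\ F =1 id,
      set_bij [set m : mor C | is_iso (arr m)]
              [set m : mor D | is_iso (arr m)] (fmor F)
    & set_bij [set m : mor C | unfactorizable (arr m)]
              [set m : mor D | unfactorizable (arr m)] (fmor F)].

(* An (H, G)-biset, not necessarily finite.  A quiver whose category is
   isomorphic to a finite one only carries finite bisets. *)
Record biset (H G : finGroupType) := Biset {
  bset :> choiceType;
  lact : H -> bset -> bset;
  ract : bset -> G -> bset;
  lact1 : forall x, lact 1%g x = x;
  lactM : forall h k x, lact (h * k)%g x = lact h (lact k x);
  ract1 : forall x, ract x 1%g = x;
  ractM : forall x g h, ract x (g * h)%g = ract (ract x g) h;
  lractA : forall h x g, lact h (ract x g) = ract (lact h x) g
}.

(* The relation (x k, y) ~ (x, k y) is already an equivalence. *)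
Definition bprod_rel (H K G : finGroupType) (X : biset H K) (Y : biset K G)
    (p q : X * Y) : bool :=
  [exists k : K, (p.1 == ract q.1 k) && (q.2 == lact k p.2)].

Lemma bprod_refl (H K G : finGroupType) (X : biset H K) (Y : biset K G) :
  reflexive (@bprod_rel H K G X Y).
Proof. by move=> p; apply/existsP; exists 1%g; rewrite ract1 lact1 !eqxx. Qed.

Lemma bprod_sym (H K G : finGroupType) (X : biset H K) (Y : biset K G) :
  symmetric (@bprod_rel H K G X Y).
Proof.
have imp p q : @bprod_rel H K G X Y p q -> @bprod_rel H K G X Y q p.
  case/existsP=> k /andP[/eqP e1 /eqP e2]; apply/existsP; exists (k^-1)%g.
  by rewrite e1 e2 -ractM -lactM mulgV mulVg ract1 lact1 !eqxx.
by move=> p q; apply/idP/idP; apply: imp.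
Qed.

Lemma bprod_trans (H K G : finGroupType) (X : biset H K) (Y : biset K G) :
  transitive (@bprod_rel H K G X Y).
Proof.
move=> q p r /existsP[k /andP[/eqP e1 /eqP e2]].
case/existsP=> l /andP[/eqP e3 /eqP e4]; apply/existsP; exists (l * k)%g.
by rewrite e1 e3 e4 e2 ractM lactM !eqxx.
Qed.

Definition bprod_equiv (H K G : finGroupType) (X : biset H K) (Y : biset K G) :=
  EquivRel (@bprod_rel H K G X Y) (@bprod_refl H K G X Y)
    (@bprod_sym H K G X Y) (@bprod_trans H K G X Y).

Definition bprod_set (H K G : finGroupType) (X : biset H K) (Y : biset K G) :
  choiceType := {eq_quot (bprod_equiv X Y)}.

Definition bpi (H K G : finGroupType) (X : biset H K) (Y : biset K G)
  (x : X) (y : Y) : bprod_set X Y := \pi_{eq_quot (bprod_equiv X Y)}%qT (x, y).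

Definition brepr (H K G : finGroupType) (X : biset H K) (Y : biset K G)
  (c : bprod_set X Y) : X * Y := repr (c : {eq_quot (bprod_equiv X Y)}).

Lemma bpiP (H K G : finGroupType) (X : biset H K) (Y : biset K G)
    (x x' : X) (y y' : Y) :
  bpi x y = bpi x' y' <-> exists k, x = ract x' k /\ y' = lact k y.
Proof.
split=> [/eqmodP/existsP[k /andP[/eqP e1 /eqP e2]]|[k [e1 e2]]].
  by exists k.
by apply/eqmodP/existsP; exists k; rewrite /= e1 e2 !eqxx.
Qed.

Lemma bpi_act (H K G : finGroupType) (X : biset H K) (Y : biset K G)
    (x : X) (k : K) (y : Y) :
  bpi (ract x k) y = bpi x (lact k y).
Proof. by apply/bpiP; exists k. Qed.

Lemma breprK (H K G : finGroupType) (X : biset H K) (Y : biset K G)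
    (c : bprod_set X Y) :
  bpi (brepr c).1 (brepr c).2 = c.
Proof. by rewrite /bpi -surjective_pairing /brepr reprK. Qed.

Lemma bprodW (H K G : finGroupType) (X : biset H K) (Y : biset K G)
    (P : bprod_set X Y -> Prop) :
  (forall x y, P (bpi x y)) -> forall c, P c.
Proof. by move=> Ppi c; rewrite -(breprK c). Qed.

Definition bprod_lact (H K G : finGroupType) (X : biset H K) (Y : biset K G)
    (h : H) (c : bprod_set X Y) :=
  bpi (lact h (brepr c).1) (brepr c).2.

Definition bprod_ract (H K G : finGroupType) (X : biset H K) (Y : biset K G)
    (c : bprod_set X Y) (g : G) :=
  bpi (brepr c).1 (ract (brepr c).2 g).

Lemma bprod_lactE (H K G : finGroupType) (X : biset H K) (Y : biset K G)
    (h : H) (x : X) (y : Y) :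
  bprod_lact h (bpi x y) = bpi (lact h x) y.
Proof.
have := breprK (bpi x y); rewrite /bprod_lact.
by case: (brepr _) => a b /= /bpiP[k [-> ->]]; rewrite lractA bpi_act.
Qed.

Lemma bprod_ractE (H K G : finGroupType) (X : biset H K) (Y : biset K G)
    (x : X) (y : Y) (g : G) :
  bprod_ract (bpi x y) g = bpi x (ract y g).
Proof.
have := breprK (bpi x y); rewrite /bprod_ract.
by case: (brepr _) => a b /= /bpiP[k [-> ->]]; rewrite -lractA bpi_act.
Qed.

Lemma bprod_lact1 (H K G : finGroupType) (X : biset H K) (Y : biset K G)
    (c : bprod_set X Y) : bprod_lact 1%g c = c.
Proof. by move: c; apply: bprodW => x y; rewrite bprod_lactE lact1. Qed.

Lemma bprod_lactM (H K G : finGroupType) (X : biset H K) (Y : biset K G)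
    (h k : H) (c : bprod_set X Y) :
  bprod_lact (h * k)%g c = bprod_lact h (bprod_lact k c).
Proof. by move: c; apply: bprodW => x y; rewrite !bprod_lactE lactM. Qed.

Lemma bprod_ract1 (H K G : finGroupType) (X : biset H K) (Y : biset K G)
    (c : bprod_set X Y) : bprod_ract c 1%g = c.
Proof. by move: c; apply: bprodW => x y; rewrite bprod_ractE ract1. Qed.

Lemma bprod_ractM (H K G : finGroupType) (X : biset H K) (Y : biset K G)
    (c : bprod_set X Y) (g h : G) :
  bprod_ract c (g * h)%g = bprod_ract (bprod_ract c g) h.
Proof. by move: c; apply: bprodW => x y; rewrite !bprod_ractE ractM. Qed.

Lemma bprod_lractA (H K G : finGroupType) (X : biset H K) (Y : biset K G)
    (h : H) (c : bprod_set X Y) (g : G) :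
  bprod_lact h (bprod_ract c g) = bprod_ract (bprod_lact h c) g.
Proof.
by move: c; apply: bprodW => x y; rewrite !(bprod_ractE, bprod_lactE).
Qed.

Definition bprod (H K G : finGroupType) (X : biset H K) (Y : biset K G) :
    biset H G :=
  Biset (@bprod_lact1 H K G X Y) (@bprod_lactM H K G X Y)
    (@bprod_ract1 H K G X Y) (@bprod_ractM H K G X Y)
    (@bprod_lractA H K G X Y).

(* Only paths of positive length. *)
Inductive dpath (Q0 Q1 : Type) (s t : Q1 -> Q0) : Q0 -> Q0 -> Type :=
| parrow (a : Q1) : dpath s t (s a) (t a)
| psnoc (v : Q0) (a : Q1) : dpath s t v (s a) -> dpath s t v (t a).
Arguments parrow {Q0 Q1 s t} a.
Arguments psnoc {Q0 Q1 s t v} a p.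

(* Right to left, like composition: p comes first. *)
Fixpoint pcat (Q0 Q1 : Type) (s t : Q1 -> Q0) (u v w : Q0)
    (q : dpath s t v w) : dpath s t u v -> dpath s t u w :=
  match q in dpath _ _ v w return dpath s t u v -> dpath s t u w with
  | parrow a => fun p => psnoc a p
  | psnoc v a q => fun p => psnoc a (pcat q p)
  end.

Record EIquiver := EIQuiver {
  vertex : finType;
  arrow : finType;
  src : arrow -> vertex;
  tgt : arrow -> vertex;
  acyclic : forall v, dpath src tgt v v -> False;
  vgrp : vertex -> finGroupType;
  abiset : forall a : arrow, biset (vgrp (tgt a)) (vgrp (src a))
}.

Definition path (Q : EIquiver) := dpath (@src Q) (@tgt Q).

(* H_p = g(alpha_n) * (g(alpha_(n-1)) * ( ... * g(alpha_1))). *)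
Fixpoint pbiset (Q : EIquiver) (v w : vertex Q) (p : path v w) :
    biset (vgrp w) (vgrp v) :=
  match p in dpath _ _ v w return biset (vgrp w) (vgrp v) with
  | parrow a => abiset a
  | psnoc v a p => bprod (abiset a) (pbiset p)
  end.

(* The natural map H_q x H_p -> H_(qp), computed on representatives; by
   pmul_bpi it does not depend on their choice. *)
Fixpoint pmul (Q : EIquiver) (u v w : vertex Q) (q : path v w) :
    forall p : path u v, pbiset q -> pbiset p -> pbiset (pcat q p) :=
  match q in dpath _ _ v w
    return forall p : path u v, pbiset q -> pbiset p -> pbiset (pcat q p) with
  | parrow a => fun p y x => bpi (y : abiset a) x
  | psnoc v a q => fun p c x => bpi (brepr c).1 (pmul (brepr c).2 x)
  end.

Lemma pmul_lact (Q : EIquiver) (u v w : vertex Q) (q : path v w)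
    (p : path u v) (h : vgrp w) (y : pbiset q) (x : pbiset p) :
  pmul (lact h y) x = lact h (pmul y x).
Proof.
elim: q p h y x => [a|{}v a q IHq] p h y x /=; first by rewrite bprod_lactE.
rewrite bprod_lactE /bprod_lact.
have := breprK (bpi (lact h (brepr y).1) (brepr y).2).
by case: (brepr (bpi _ _)) => b c /= /bpiP[k [-> ->]]; rewrite IHq bpi_act.
Qed.

Lemma pmul_bpi (Q : EIquiver) (u v : vertex Q) (a : arrow Q)
    (q : path v (src a)) (p : path u v) (y : abiset a) (z : pbiset q)
    (x : pbiset p) :
  @pmul Q u v (tgt a) (psnoc a q) p (bpi y z) x = bpi y (pmul z x).
Proof.
move=> /=; have := breprK (bpi y z).
by case: (brepr _) => b c /= /bpiP[k [-> ->]]; rewrite pmul_lact bpi_act.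
Qed.

Lemma pmul_ract (Q : EIquiver) (u v w : vertex Q) (q : path v w)
    (p : path u v) (y : pbiset q) (x : pbiset p) (g : vgrp u) :
  pmul y (ract x g) = ract (pmul y x) g.
Proof.
elim: q p y x => [a|{}v a q IHq] p y x /=; first by rewrite bprod_ractE.
by rewrite bprod_ractE IHq.
Qed.

Lemma pmul_mid (Q : EIquiver) (u v w : vertex Q) (q : path v w)
    (p : path u v) (y : pbiset q) (k : vgrp v) (x : pbiset p) :
  pmul (ract y k) x = pmul y (lact k x).
Proof.
elim: q p y k x => [a|{}v a q IHq] p y k x; first exact: bpi_act.
move: y; apply: bprodW => y z.
by rewrite [ract _ _]bprod_ractE !pmul_bpi IHq.
Qed.

(* Hom(v, w): group elements when v = w, together with the disjoint union of
   the H_p over the paths p of positive length.  As the quiver is acyclic,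
   only the former occur when v = w and only the latter when v <> w. *)
Inductive qhom (Q : EIquiver) (v : vertex Q) : vertex Q -> Type :=
| qgrp of vgrp v : qhom v v
| qpth (w : vertex Q) (p : path v w) of pbiset p : qhom v w.
Arguments qgrp {Q v} g.
Arguments qpth {Q v w p} x.

Definition qcomp (Q : EIquiver) (u v w : vertex Q) (g : qhom v w) :
    qhom u v -> qhom u w :=
  match g in qhom _ w return qhom u v -> qhom u w with
  | qgrp h => fun f =>
      match f in qhom _ v return vgrp v -> qhom u v with
      | qgrp k => fun h => qgrp (h * k)%g
      | qpth _ _ x => fun h => qpth (lact h x)
      end h
  | qpth w q y => fun f =>
      match f in qhom _ v
        return forall q : path v w, pbiset q -> qhom u w with
      | qgrp k => fun q y => qpth (ract y k)
      | qpth _ _ x => fun q y => qpth (pmul y x)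
      end q y
  end.

Lemma qcomp1m (Q : EIquiver) (v w : vertex Q) (f : qhom v w) :
  qcomp (qgrp 1%g) f = f.
Proof. by case: f => [k|{}w p x] /=; rewrite ?mul1g ?lact1. Qed.

Lemma qcompm1 (Q : EIquiver) (v w : vertex Q) (f : qhom v w) :
  qcomp f (qgrp 1%g) = f.
Proof. by case: f => [k|{}w p x] /=; rewrite ?mulg1 ?ract1. Qed.

Definition qsnoc (Q : EIquiver) (u : vertex Q) (a : arrow Q) (y : abiset a)
    (f : qhom u (src a)) : qhom u (tgt a) := qcomp (@qpth Q _ _ (parrow a) y) f.

Lemma qpth_pmulA (Q : EIquiver) (u v w z : vertex Q) (r : path w z)
    (q : path v w) (p : path u v) (c : pbiset r) (b : pbiset q) (a : pbiset p) :
  qpth (pmul c (pmul b a)) = qpth (pmul (pmul c b) a).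
Proof.
elim: r q c b => [e|{}w e r IHr] q c b.
  exact: congr1 (esym (pmul_bpi c b a)).
move: c; apply: bprodW => y c.
have E : pmul (pmul (q := psnoc e r) (bpi y c) b) a = bpi y (pmul (pmul c b) a).
  by rewrite (pmul_bpi y c b); exact: pmul_bpi.
rewrite E pmul_bpi; exact: (congr1 (qsnoc y) (IHr q c b)).
Qed.

Lemma qcompA (Q : EIquiver) (x y z w : vertex Q) (h : qhom z w) (g : qhom y z)
    (f : qhom x y) :
  qcomp h (qcomp g f) = qcomp (qcomp h g) f.
Proof.
case: h => [k|{}w r c].
  case: g f k => [l|{}z q b] f k.
    by case: f k l => [m|{}y p a] k l /=; rewrite ?mulgA ?lactM.
  by case: f q b => [m|{}y p a] q b /=; rewrite ?lractA ?pmul_lact.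
case: g f r c => [l|{}z q b] f r c.
  by case: f l r c => [m|{}y p a] l r c /=; rewrite ?ractM ?pmul_mid.
case: f q b => [m|{}y p a] q b /=; first by rewrite pmul_ract.
exact: qpth_pmulA.
Qed.

Definition quiver_cat (Q : EIquiver) : category (vertex Q) :=
  @Category (vertex Q) (@qhom Q) (fun v => qgrp 1%g) (@qcomp Q)
    (@qcomp1m Q) (@qcompm1 Q) (@qcompA Q).

Lemma qgrp_bij (Q : EIquiver) (v : vertex Q) : bijective (@qgrp Q v).
Proof.
pose inv w (e : v = w) (f : qhom v w) : vgrp v :=
  match f with
  | qgrp k => k
  | qpth w p x => 1%g
  end.
exists (inv v erefl) => // f.
have noloop w (p : path v w) : v = w -> False.
  by move=> e; move: p; rewrite -e; apply: acyclic.
suff: forall w (e : v = w) (f : qhom v w),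
    qgrp (inv w e f) = eq_rect_r (qhom v) f e by move/(_ v erefl f).
by move=> w e g; case: w / g e => [k|w p x] e; [rewrite (eq_axiomK e)|case: (noloop w p e)].
Qed.

Definition finite_free_EI (obj : Type) (C : category obj) :=
  finite_EI C /\ exists Q : EIquiver, cat_iso C (quiver_cat Q).

Definition free_EI_cover (obj : Type) (C' C : category obj) :=
  finite_free_EI C' /\
  exists F : functor C' C, full F /\ identity_on_iso_unfact F.

(* Main.v *)
(* A free EI category has a universal property: a functor out of it is the same
   as a compatible choice of group morphisms on the vertices and of biset maps
   on the arrows.  The quiver whose arrows are the pairs (x, y) joined by an
   unfactorizable morphism, with the biset of all those morphisms, therefore
   generates a free category mapping to C.  The number of objects mapping to a
   given one increases strictly along non-isomorphisms, so every morphism of C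
   is a composite of isomorphisms and unfactorizable morphisms, and the functor
   is full.  For uniqueness, two covers of C have the same isomorphisms and
   unfactorizable morphisms, so the universal property gives functors over C in
   both directions; their composites fix the isomorphisms and the
   unfactorizable morphisms, hence everything. *)
From HB Require Import structures.
From mathcomp Require Import all_boot all_fingroup.
From mathcomp Require Import boolp classical_sets functions cardinality.
Require Import Defs.

Set Implicit Arguments.
Unset Strict Implicit.
Unset Printing Implicit Defensive.

Local Open Scope classical_set_scope.

(** * Finite types out of finite sets of objects and morphisms *)

Section FiniteCarrier.

Context (T : Type) (Tfin : finite_set [set: T]).

Definition finite_enum : seq {classic T} :=
  projT1 (cid ((@finite_seqP {classic T} _).1 Tfin)).

Lemma mem_finite_enum (x : {classic T}) : x \in finite_enum.
Proof.
rewrite /finite_enum; case: cid => s /= es.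
by have : [set: {classic T}] x by []; rewrite es.
Qed.

Definition finite_code (x : T) : seq_sub finite_enum :=
  SeqSub (mem_finite_enum x).

Definition finite_decode (u : seq_sub finite_enum) : T := ssval u.

Lemma finite_codeK : cancel finite_code finite_decode.
Proof. by []. Qed.

(* The carrier is convertible to T, which avoids transport along a bijection. *)
Definition finite_carrier : finType := can_type finite_codeK.

End FiniteCarrier.

Lemma finite_set_dom (obj : Type) (C : category obj) :
  finite_set [set: mor C] -> finite_set [set: obj].
Proof.
move=> Cfin; have -> : [set: obj] = @dom _ C @` [set: mor C].
  by apply/seteqP; split=> // x _; exists (Mor (idm C x)).
exact: finite_image.
Qed.

(** Proof irrelevance makes equality proofs between objects unique, so an arrow can be recovered
    from its record. *)
Lemma Mor_inj (obj : Type) (C : category obj) (x y : obj) :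
  injective (fun f : C x y => Mor f).
Proof.
move=> f g e.
(* A left inverse of [Mor]; [f] is only the default value for morphisms with other end points. *)
pose cast (m : mor C) : C x y := if pselect (dom m = x /\ cod m = y) is left e
  then eq_rect _ (C x) (eq_rect _ (fun z => C z (cod m)) (arr m) _ e.1) _ e.2
  else f.
have castE h : cast (Mor h) = h.
  rewrite /cast; case: pselect => [[e1 e2]|[]] //=.
  move: (proj1 _) (proj2 _) => /= p q.
  rewrite (Prop_irrelevance p erefl).
  by rewrite (Prop_irrelevance q erefl).
by rewrite -(castE f) e castE.
Qed.

Lemma finite_set_hom (obj : Type) (C : category obj) (x y : obj) :
  finite_set [set: mor C] -> finite_set [set: C x y].
Proof.
move=> Cfin.
suff -> : [set: C x y] = (fun f : C x y => Mor f) @^-1` [set: mor C].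
  by apply: finite_preimage => // f g _ _; apply: Mor_inj.
by apply/seteqP.
Qed.

(** * Isomorphisms and unfactorizable morphisms under composition *)

Section Isomorphisms.

Context (obj : Type) (C : category obj).

Lemma is_iso_id (x : obj) : is_iso (idm C x).
Proof. by exists (idm C x); rewrite comp1m. Qed.

Lemma is_iso_comp (x y z : obj) (g : C y z) (f : C x y) :
  is_iso g -> is_iso f -> is_iso (comp g f).
Proof.
case=> g' [gK Kg] [f' [fK Kf]]; exists (comp f' g'); split.
  by rewrite -compA (compA g') gK comp1m.
by rewrite -compA (compA f) Kf comp1m.
Qed.

Lemma is_iso_compIr (x y z : obj) (g : C y z) (f : C x y) :
  is_iso f -> is_iso (comp g f) -> is_iso g.
Proof.
move=> [f' [fK Kf]] gf; rewrite -(compm1 g) -Kf compA; apply: is_iso_comp => //.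
by exists f.
Qed.

Lemma is_iso_compIl (x y z : obj) (g : C y z) (f : C x y) :
  is_iso g -> is_iso (comp g f) -> is_iso f.
Proof.
move=> [g' [gK Kg]] gf; rewrite -(comp1m f) -gK -compA.
apply: is_iso_comp => //.
by exists g.
Qed.

(** A factorization [h k] of [g f] yields the factorization [(g' h) k] of [f], where [g'] is the
    inverse of [g]. *)
Lemma unfactorizable_isol (x y z : obj) (g : C y z) (f : C x y) :
  is_iso g -> unfactorizable f -> unfactorizable (comp g f).
Proof.
move=> gi [fni fu]; split=> [gf|t h k e]; first exact/fni/(is_iso_compIl gi).
have [g' [gK Kg]] := gi.
have g'i : is_iso g' by exists g.
have [] := fu t (comp g' h) k; first by rewrite -compA -e compA gK comp1m.
  by left.
by move/(is_iso_compIl g'i); right.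
Qed.

Lemma unfactorizable_isor (x y z : obj) (g : C y z) (f : C x y) :
  is_iso f -> unfactorizable g -> unfactorizable (comp g f).
Proof.
move=> fi [gni gu]; split=> [gf|t h k e]; first exact/gni/(is_iso_compIr fi).
have [f' [fK Kf]] := fi.
have f'i : is_iso f' by exists f.
have [] := gu t h (comp k f'); first by rewrite compA -e -compA Kf compm1.
  by move/(is_iso_compIr f'i); left.
by right.
Qed.

End Isomorphisms.

Lemma is_iso_fmap (obj obj' : Type) (C : category obj) (D : category obj')
    (F : functor C D) (x y : obj) (f : C x y) :
  is_iso f -> is_iso (fmap F f).
Proof.
by case=> g [gK Kg]; exists (fmap F g); rewrite -!fmapM gK Kg !fmap1.
Qed.

(** * Automorphism groups of an EI category *)

Section AutomorphismGroup.

Context (obj : Type) (C : category obj) (EI : finite_EI C).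

Definition endo_inv (x : obj) (f : C x x) : C x x := projT1 (cid (EI.2 x f)).

Lemma endo_mulVg (x : obj) (f : C x x) : comp (endo_inv f) f = idm C x.
Proof. by rewrite /endo_inv; case: cid => g []. Qed.

Definition hom_finType (x y : obj) : finType :=
  finite_carrier (@finite_set_hom obj C x y EI.1).

(** The carrier stays convertible to [C x x], so group elements are used directly as morphisms of
    [C]. *)
Definition autgrp (x : obj) : finGroupType :=
  HB.pack (Finite.sort (hom_finType x x))
    (@Finite_isGroup.Build (hom_finType x x) (@comp _ C x x x) (idm C x)
       (@endo_inv x) (@compA _ C x x x x) (@comp1m _ C x x) (@endo_mulVg x)).

End AutomorphismGroup.

(** * The category generated by a quiver: generators, isomorphisms, unfactorizable morphisms *)

Section QuiverCategory.

Context (Q : EIquiver).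

Definition qedge (a : arrow Q) (y : abiset a) :
  quiver_cat Q (src a) (tgt a) := @qpth Q (src a) (tgt a) (parrow a) y.

(** Group elements and edges generate: over a path [psnoc a p], the class [bpi y x] is the composite
    of the edge [y] with [qpth x]. *)
Lemma quiver_ind (P : forall v w : vertex Q, quiver_cat Q v w -> Prop) :
  (forall v (k : vgrp v), P v v (qgrp k)) ->
  (forall a (y : abiset a), P (src a) (tgt a) (qedge y)) ->
  (forall u v w (g : quiver_cat Q v w) (f : quiver_cat Q u v),
     P v w g -> P u v f -> P u w (comp g f)) ->
  forall v w f, P v w f.
Proof.
move=> Pgrp Pedge Pcomp v w [k|{}w p x]; first exact: Pgrp.
elim: p x => [a|{}v a p IHp] x; first exact: Pedge.
move: x; apply: bprodW => y x; exact: (Pcomp _ _ _ _ _ (Pedge a y) (IHp x)).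
Qed.

Fixpoint plen (v w : vertex Q) (p : path v w) : nat :=
  match p with parrow _ => 1 | psnoc _ _ p => (plen p).+1 end.

Lemma plen_cat (u v w : vertex Q) (q : path v w) (p : path u v) :
  plen (pcat q p) = plen q + plen p.
Proof. by elim: q p => //= {}v a q IHq p; rewrite IHq. Qed.

Lemma plen_gt0 (v w : vertex Q) (p : path v w) : 0 < plen p.
Proof. by case: p. Qed.

(** A degree, additive under composition: isomorphisms are the morphisms of degree 0, edges those of
    degree 1. *)
Definition qlen v w (f : quiver_cat Q v w) : nat :=
  match f with qgrp _ => 0 | qpth _ p _ => plen p end.

Lemma qlen_comp u v w (g : quiver_cat Q v w) (f : quiver_cat Q u v) :
  qlen (comp g f) = qlen g + qlen f.
Proof.
case: g f => [h|{}w q y] f /=; first by case: f h.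
by case: f q y => [k|{}v p x] q y /=; rewrite ?addn0 ?plen_cat.
Qed.

Lemma is_iso_qlen v w (f : quiver_cat Q v w) : is_iso f <-> qlen f = 0.
Proof.
split=> [[g [gK _]]|].
  have : qlen (comp g f) = 0 by rewrite gK.
  by rewrite qlen_comp => /eqP; rewrite addn_eq0 => /andP[_ /eqP].
case: f => [k _|{}w p x /= p0]; last by have := plen_gt0 p; rewrite p0.
by exists (qgrp k^-1%g) => /=; rewrite mulgV mulVg.
Qed.

Lemma is_iso_endo v (f : quiver_cat Q v v) : is_iso f.
Proof. by have [g _ gK] := qgrp_bij v; rewrite -(gK f); apply/is_iso_qlen. Qed.

(** Degree 1 splits only as 0 + 1 or 1 + 0. *)
Lemma unfactorizable_edge a (y : abiset a) : unfactorizable (qedge y).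
Proof.
split=> [/is_iso_qlen //|z g b e].
have : qlen (comp g b) = 1 by rewrite -e.
rewrite qlen_comp !is_iso_qlen.
by case: (qlen g) => [|[|m]]; case: (qlen b) => [|[|n]] //; auto.
Qed.

(** Over a longer path, splitting off the last arrow gives two factors of positive degree. *)
Lemma unfactorizable_edgeP v w (f : quiver_cat Q v w) :
  unfactorizable f ->
  exists a (y : abiset a), Mor f = Mor (qedge y).
Proof.
case: f => [k [[]]|{}w p x]; first exact/is_iso_qlen.
case: p x => [a|{}v a p] x; first by exists a, x.
move: x; apply: bprodW => y x [_ /(_ _ (qedge y) (qpth x) erefl)].
case=> /is_iso_qlen //= p0.
by have := plen_gt0 p; rewrite p0.
Qed.

Lemma is_iso_grpP v w (f : quiver_cat Q v w) :
  is_iso f -> exists k : vgrp v, Mor f = Mor (C := quiver_cat Q) (qgrp k).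
Proof.
move/is_iso_qlen; case: f => [k _|{}w p x /= p0]; first by exists k.
by have := plen_gt0 p; rewrite p0.
Qed.

End QuiverCategory.

(** * The universal property of the category generated by a quiver *)

Section Lift.

Context (Q : EIquiver) (obj : Type) (D : category obj) (o : vertex Q -> obj).
Context (lgrp : forall v : vertex Q, vgrp v -> D (o v) (o v)).
Context (ledge : forall a : arrow Q, abiset a -> D (o (src a)) (o (tgt a))).

Fixpoint lift_path (v w : vertex Q) (p : path v w) :
    pbiset p -> D (o v) (o w) :=
  match p in dpath _ _ v w return pbiset (p : path v w) -> D (o v) (o w) with
  | parrow a => fun y => ledge (y : abiset a)
  | psnoc v a p => fun c => comp (ledge (brepr c).1) (lift_path (brepr c).2)
  end.

Definition lift_hom v w (f : quiver_cat Q v w) : D (o v) (o w) :=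
  match f with
  | qgrp k => lgrp k
  | qpth w p x => lift_path x
  end.

Hypothesis lgrp1 : forall v, lgrp (1%g : vgrp v) = idm D (o v).
Hypothesis lgrpM : forall v (h k : vgrp v),
  lgrp (h * k)%g = comp (lgrp h) (lgrp k).
Hypothesis ledgel : forall a (y : abiset a) h,
  ledge (lact h y) = comp (lgrp h) (ledge y).
Hypothesis ledger : forall a (y : abiset a) k,
  ledge (ract y k) = comp (ledge y) (lgrp k).

(** The chosen representative differs from [(y, x)] by some [k], which equivariance moves across.
    Left equivariance along [p] is a premise because [lift_path_lact] obtains it by an induction
    that uses this formula. *)
Lemma lift_path_bpi (v : vertex Q) (a : arrow Q) (p : path v (src a))
    (y : abiset a) (x : pbiset p) :
  (forall k, lift_path (lact k x) = comp (lgrp k) (lift_path x)) ->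
  lift_path (p := psnoc a p) (bpi y x) = comp (ledge y) (lift_path x).
Proof.
move=> xl /=; have := breprK (bpi y x).
case: (brepr _) => b c /= /esym/bpiP[k [-> ->]].
by rewrite xl ledger compA.
Qed.

Lemma lift_path_lact (v w : vertex Q) (p : path v w) h (x : pbiset p) :
  lift_path (lact h x) = comp (lgrp h) (lift_path x).
Proof.
elim: p h x => [a|{}v a p IHp] h x; first exact: ledgel.
move: x; apply: bprodW => y x.
rewrite [lact _ _]bprod_lactE !lift_path_bpi => [|k|k]; try exact: IHp.
by rewrite ledgel compA.
Qed.

Lemma lift_path_ract (v w : vertex Q) (p : path v w) k (x : pbiset p) :
  lift_path (ract x k) = comp (lift_path x) (lgrp k).
Proof.
elim: p k x => [a|{}v a p IHp] k x; first exact: ledger.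
move: x; apply: bprodW => y x.
rewrite [ract _ _]bprod_ractE !lift_path_bpi => [|h|h];
  try exact: lift_path_lact.
by rewrite IHp compA.
Qed.

Lemma lift_path_mul (u v w : vertex Q) (q : path v w) (p : path u v)
    (y : pbiset q) (x : pbiset p) :
  lift_path (pmul y x) = comp (lift_path y) (lift_path x).
Proof.
elim: q p y x => [a|{}v a q IHq] p y x.
  by apply: lift_path_bpi => k; apply: lift_path_lact.
move: y; apply: bprodW => b y.
rewrite pmul_bpi !lift_path_bpi => [|k|k]; try exact: lift_path_lact.
by rewrite IHq compA.
Qed.

Lemma lift_hom_comp u v w (g : quiver_cat Q v w) (f : quiver_cat Q u v) :
  lift_hom (comp g f) = comp (lift_hom g) (lift_hom f).
Proof.
case: g f => [h|{}w q y] f /=.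
  by case: f h => [k|{}v p x] h /=; rewrite ?lgrpM ?lift_path_lact.
by case: f q y => [k|{}v p x] q y /=; rewrite ?lift_path_ract ?lift_path_mul.
Qed.

Definition quiver_lift : functor (quiver_cat Q) D :=
  @Functor _ _ (quiver_cat Q) D o lift_hom lgrp1 lift_hom_comp.

End Lift.

Lemma is_iso_split (obj : Type) (C : category obj) (x y : obj) (f : C x y)
    (l r : C y x) :
  comp l f = idm C x -> comp f r = idm C y -> is_iso f.
Proof.
move=> lf fr; exists r; split=> //.
by rewrite -lf -[l in RHS]compm1 -fr compA lf comp1m.
Qed.

(** * Rank of objects and generation by isomorphisms and unfactorizable morphisms *)

Section Rank.

Context (obj : finType) (C : category obj).
Hypothesis EI : forall (x : obj) (f : C x x), is_iso f.

Definition rank (y : obj) : nat := #|[pred z | `[< inhabited (C z y) >]]|.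

(** Composing with [f] gives the inclusion of the sets counted. *)
Lemma rank_lt (x y : obj) (f : C x y) : ~ is_iso f -> rank x < rank y.
Proof.
move=> fni; apply: proper_card; apply/fintype.properP; split.
  apply/fintype.subsetP => z; rewrite !unfold_in /= => /asboolP; case=> g.
  by apply/asboolP; exists; exact: (comp f g).
(* The new object is [y]: given [g] from [y] to [x], the endomorphisms [g f] and [f g] would be
   invertible, giving [f] a left and a right inverse. *)
exists y; rewrite !unfold_in /=; first by apply/asboolP; exists; exact: idm.
apply/negP => /asboolP; case=> g; apply: fni.
have [h [hK _]] := EI (comp g f); have [k [_ Kk]] := EI (comp f g).
apply: (@is_iso_split _ _ _ _ f (comp h g) (comp g k)).
  by rewrite -compA.
by rewrite compA.
Qed.

(* The rank strictly increases along both factors of a proper factorization,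
   so refining factorizations terminates. *)
Lemma EI_ind (P : forall x y : obj, C x y -> Prop) :
  (forall x y (f : C x y), is_iso f -> P x y f) ->
  (forall x y (f : C x y), unfactorizable f -> P x y f) ->
  (forall x y z (g : C y z) (f : C x y),
     P y z g -> P x y f -> P x z (comp g f)) ->
  forall x y f, P x y f.
Proof.
move=> Piso Punf Pcomp x y f; have [n] := ubnP (rank y - rank x).
elim: n x y f => // n IHn x y f; rewrite ltnS => lt_n.
have [fi|fni] := pselect (is_iso f); first exact: Piso.
have [fu|] := pselect (unfactorizable f); first exact: Punf.
move/not_andP => [//|/existsNP[z /existsNP[g /existsNP[b /not_implyP[-> ]]]]].
move/not_orP => [bni gni].
have bx := rank_lt bni; have gy := rank_lt gni.
apply: Pcomp; apply: IHn; apply: leq_trans lt_n.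
  by rewrite ltn_sub2l // (ltn_trans bx).
by rewrite ltn_sub2r // (ltn_trans bx).
Qed.

End Rank.

(** * Finiteness of the category generated by a quiver *)

Section FiniteQuiver.

Context (Q : EIquiver) (r : vertex Q -> nat).
Hypothesis bfin : forall a : arrow Q, finite_set [set: abiset a].
Hypothesis r_lt : forall a : arrow Q, r (src a) < r (tgt a).

(** Each arrow of a path raises [r] by at least one. *)
Lemma qlen_le (v w : vertex Q) (f : quiver_cat Q v w) : qlen f + r v <= r w.
Proof.
move: v w f; apply: quiver_ind => [v k|a y|u v w g f IHg IHf] //.
rewrite qlen_comp -addnA; apply: leq_trans IHg.
by rewrite leq_add2l.
Qed.

Lemma finite_quiver_cat : finite_set [set: mor (quiver_cat Q)].
Proof.
(* Degrees are bounded by the maximum of [r], so finiteness follows by induction on a bound for the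
   degree. *)
suff fin n : finite_set [set m : mor (quiver_cat Q) | qlen (arr m) <= n].
  apply: sub_finite_set (fin (\max_v r v)) => -[v w f] _ /=.
  apply: (@leq_trans (r w)); last exact: leq_bigmax.
  exact: leq_trans (leq_addr _ _) (qlen_le f).
elim: n => [|n IHn].
  apply: (@sub_finite_set _ _ (\bigcup_(v in [set: vertex Q])
      [set Mor (C := quiver_cat Q) (qgrp k) | k in [set: vgrp v]])).
    move=> [v w f] /=; rewrite leqn0 => /eqP/is_iso_qlen/is_iso_grpP[k ->].
    by exists v => //; exists k.
  by apply: bigcup_finite => // v _; apply: finite_image.
have homfin v w : finite_set [set f : quiver_cat Q v w | qlen f <= n].
  rewrite (_ : mkset _ = (fun f : quiver_cat Q v w => Mor f) @^-1`
    [set m | qlen (arr m) <= n]) //.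
  by apply: finite_preimage => // f g _ _; apply: Mor_inj.
pose ext (u : vertex Q) (a : arrow Q)
    (yf : abiset a * quiver_cat Q u (src a)) :=
  Mor (comp (qedge yf.1) yf.2).
(* A morphism of degree at most [n.+1] is a group element, a single edge, or an edge after a
   morphism of degree at most [n]. *)
apply: (@sub_finite_set _ _ ([set m | qlen (arr m) <= n] `|`
    \bigcup_(u in [set: vertex Q]) \bigcup_(a in [set: arrow Q])
      (@ext u a @` ([set: abiset a] `*` [set f | qlen f <= n]) `|`
       [set Mor (qedge y) | y in [set: abiset a]]))).
  move=> [u w [k|{}w p x]] /=; first by left.
  case: p x => [a|{}u a p] x lt_n.
    by right; exists (src a) => //; exists a => //; right; exists x.
  right; exists u => //; exists a => //; left.
  move: x; apply: bprodW => y x.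
  by exists (y, qpth x).
rewrite finite_setU; split=> //.
apply: bigcup_finite => // u _; apply: bigcup_finite => // a _.
rewrite finite_setU; split; apply: finite_image => //.
exact: finite_setX.
Qed.

End FiniteQuiver.

(** Such a functor reflects isomorphisms: if [F g] is one, skeletality makes [g] an endomorphism,
    hence invertible. *)
Lemma functor_unfactorizable (obj : Type) (C D : category obj)
    (F : functor C D) :
  (forall (x : obj) (f : C x x), is_iso f) -> skeletal D -> F =1 id ->
  forall (x y : obj) (f : C x y), unfactorizable (fmap F f) -> unfactorizable f.
Proof.
(* Replacing the object map by [id] itself lets [F] send [C x y] to [D x y] without transport. *)
case: F => o F F1 FM EI skel /= /funext; rewrite -/(@id obj) => eo; subst o.
have reflect_iso a b (g : C a b) : is_iso (F a b g) -> is_iso g.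
  by move=> gi; have e := skel _ _ _ gi; subst b; apply: EI.
move=> x y f [fni fu]; split=> [[g [gK Kg]]|z g b e].
  by apply: fni; exists (F _ _ g); rewrite -!FM gK Kg !F1.
by have [] := fu z (F _ _ g) (F _ _ b);
  rewrite -?FM ?e // => /reflect_iso; auto.
Qed.

(** * The quiver of unfactorizable morphisms and its functor to [C] *)

Section UnfactorizableQuiver.

Context (obj : finType) (C : category obj) (EI : finite_EI C).

Definition unfact_arrow : finType :=
  {e : obj * obj | `[< exists f : C e.1 e.2, unfactorizable f >]}.

Definition unfact_src (a : unfact_arrow) : obj := (val a).1.
Definition unfact_tgt (a : unfact_arrow) : obj := (val a).2.

(** The rank strictly increases along every arrow. *)
Lemma unfact_acyclic (v : obj) : dpath unfact_src unfact_tgt v v -> False.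
Proof.
suff lt w : dpath unfact_src unfact_tgt v w -> rank C v < rank C w.
  by move/lt; rewrite ltnn.
have edge a : rank C (unfact_src a) < rank C (unfact_tgt a).
  by case/asboolP: (valP a) => f [fni _]; exact: rank_lt EI.2 _ _ f fni.
elim=> [a|{}v a p lt]; [exact: edge|exact: ltn_trans lt (edge a)].
Qed.

Section Biset.

Context (x y : obj).

Definition unfact_hom : choiceType :=
  {f : hom_finType EI x y | `[< @unfactorizable obj C x y f >]}.

Implicit Types u : unfact_hom.

Definition unfact_val u : C x y := val u.

Lemma unfact_valP u : unfactorizable (unfact_val u).
Proof. exact/asboolP/(valP u). Qed.

Lemma unfact_val_inj : injective unfact_val.
Proof. exact: val_inj. Qed.

Definition unfact_mk (f : C x y) (fu : unfactorizable f) : unfact_hom :=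
  exist (fun f : hom_finType EI x y => `[< @unfactorizable obj C x y f >])
    f (asboolT fu).

Definition unfact_lact (h : autgrp EI y) u : unfact_hom :=
  unfact_mk (unfactorizable_isol (EI.2 y h) (unfact_valP u)).

Definition unfact_ract u (k : autgrp EI x) : unfact_hom :=
  unfact_mk (unfactorizable_isor (EI.2 x k) (unfact_valP u)).

Lemma unfact_lact1 u : unfact_lact 1%g u = u.
Proof. by apply: unfact_val_inj; exact: (comp1m (unfact_val u)). Qed.

Lemma unfact_lactM h k u :
  unfact_lact (h * k)%g u = unfact_lact h (unfact_lact k u).
Proof. by apply: unfact_val_inj; exact: (esym (compA _ _ _)). Qed.

Lemma unfact_ract1 u : unfact_ract u 1%g = u.
Proof. by apply: unfact_val_inj; exact: (compm1 (unfact_val u)). Qed.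

Lemma unfact_ractM u h k :
  unfact_ract u (h * k)%g = unfact_ract (unfact_ract u h) k.
Proof. by apply: unfact_val_inj; exact: (compA _ _ _). Qed.

Lemma unfact_lractA h u k :
  unfact_lact h (unfact_ract u k) = unfact_ract (unfact_lact h u) k.
Proof. by apply: unfact_val_inj; exact: (compA _ _ _). Qed.

Definition unfact_biset : biset (autgrp EI y) (autgrp EI x) :=
  Biset unfact_lact1 unfact_lactM unfact_ract1 unfact_ractM unfact_lractA.

End Biset.

Definition unfact_quiver : EIquiver :=
  @EIQuiver obj unfact_arrow unfact_src unfact_tgt unfact_acyclic (autgrp EI)
    (fun a => unfact_biset (unfact_src a) (unfact_tgt a)).

Definition free_cover : category obj := quiver_cat unfact_quiver.

Lemma free_cover_finite_EI : finite_EI free_cover.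
Proof.
split; last by move=> v f; apply: is_iso_endo.
apply: (@finite_quiver_cat unfact_quiver (rank C)) => a.
  exact: (@finite_finset
    {f : hom_finType EI (unfact_src a) (unfact_tgt a) | _}).
by case/asboolP: (valP a) => f [fni _]; exact: rank_lt EI.2 _ _ f fni.
Qed.

(** Groups and bisets consist of morphisms of [C] with its composition, so every compatibility
    condition holds by conversion. *)
Definition free_cover_functor : functor free_cover C :=
  @quiver_lift unfact_quiver obj C id (fun v k => k)
    (fun a => @unfact_val (unfact_src a) (unfact_tgt a))
    (fun v => erefl) (fun v h k => erefl) (fun a y h => erefl)
    (fun a y k => erefl).

Hypothesis skel : skeletal C.

(** Isomorphisms upstairs are group elements and unfactorizable morphisms are edges; both are sent
    to the morphisms of [C] they were built from. *)
Lemma free_cover_identity : identity_on_iso_unfact free_cover_functor.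
Proof.
have iso_val m : is_iso (arr m) ->
    exists v (k : autgrp EI v),
      m = Mor (C := free_cover) (@qgrp unfact_quiver v k).
  by case: m => v w f /= /is_iso_grpP[k e]; exists v, k.
split=> //; first split.
- by move=> m mi; exact: is_iso_fmap.
- move=> m m' /set_mem mi /set_mem mi'.
  have [v [k ->]] := iso_val m mi; have [v' [k' ->]] := iso_val m' mi' => e.
  have ev : v = v' := congr1 (@dom _ _) e; subst v'.
  by rewrite (Mor_inj e : k = k').
(* By skeletality an isomorphism of [C] is an endomorphism, that is, an element of a vertex
   group. *)
- move=> [x y f] /= fi; have e := skel fi; subst y.
  exists (Mor (C := free_cover) (@qgrp unfact_quiver x f)) => //=.
  exact: is_iso_endo.
have unf_val m : unfactorizable (arr m) -> exists a (u : unfact_biset _ _),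
    m = Mor (C := free_cover) (@qedge unfact_quiver a u).
  by case: m => v w f /= /unfactorizable_edgeP.
split.
- move=> m /unf_val[a [u ->]]; exact: unfact_valP.
- move=> m m' /set_mem mu /set_mem mu'.
  have [a [u ->]] := unf_val m mu; have [a' [u' ->]] := unf_val m' mu' => e.
  (* There is one arrow per pair of objects, so the end points determine it. *)
  have ea : a = a'.
    apply: val_inj; rewrite [LHS]surjective_pairing [RHS]surjective_pairing.
    have e1 : (val a).1 = (val a').1 := congr1 (@dom _ _) e.
    have e2 : (val a).2 = (val a').2 := congr1 (@cod _ _) e.
    by rewrite e1 e2.
  subst a'.
  by rewrite (unfact_val_inj (Mor_inj e) : u = u').
move=> [x y f] /= fu.
have a : `[< exists g : C x y, unfactorizable g >] by apply/asboolP; exists f.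
pose xy : arrow unfact_quiver :=
  exist (fun e : obj * obj => `[< exists g : C e.1 e.2, unfactorizable g >])
    (x, y) a.
exists (Mor (@qedge unfact_quiver xy (unfact_mk fu))) => //.
exact: (@unfactorizable_edge unfact_quiver xy).
Qed.

End UnfactorizableQuiver.

(** * Fullness and existence of the cover *)

Lemma identity_on_iso_unfact_full (obj : finType) (C D : category obj)
    (F : functor C D) :
  (forall (x : obj) (f : D x x), is_iso f) -> skeletal D ->
  identity_on_iso_unfact F -> full F.
Proof.
case: F => o F F1 FM EI skel [/= /funext]; rewrite -/(@id obj) => eo; subst o.
move=> [_ _ Fiso] [_ _ Funf].
have lift x y (f : D x y) (m : mor C) :
    fmor (@Functor obj obj C D id F F1 FM) m = Mor f -> exists g, F x y g = f.
  case: m => a b g e; have ea : a = x := congr1 (@dom _ _) e.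
  have eb : b = y := congr1 (@cod _ _) e; subst a b.
  by exists g; apply: Mor_inj e.
apply: (EI_ind EI) => [x y f fi|x y f fu|x y z g f [g' <-] [f' <-]].
- by have [m _ /lift] := Fiso (Mor f) fi.
- by have [m _ /lift] := Funf (Mor f) fu.
- by exists (comp g' f'); exact: FM.
Qed.

Lemma cat_iso_refl (obj : Type) (C : category obj) : cat_iso C C.
Proof.
pose I := @Functor obj obj C C id (fun _ _ f => f) (fun=> erefl)
  (fun _ _ _ _ _ => erefl).
by exists I, I; split=> // -[].
Qed.

Lemma free_cover_exists (obj : finType) (C : category obj) :
  finite_EI C -> skeletal C -> exists C' : category obj, free_EI_cover C' C.
Proof.
move=> EI skel; exists (free_cover EI); split.
  split; first exact: free_cover_finite_EI.
  by exists (unfact_quiver EI); apply: cat_iso_refl.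
exists (free_cover_functor EI).
have Fid := free_cover_identity EI skel.
by split=> //; apply: identity_on_iso_unfact_full EI.2 skel Fid.
Qed.

(** * Uniqueness of the cover *)

Definition fcomp (o1 o2 o3 : Type) (C : category o1) (D : category o2)
    (E : category o3) (G : functor D E) (F : functor C D) : functor C E.
Proof.
apply: (@Functor _ _ C E (G \o F) (fun _ _ f => fmap G (fmap F f))).
  by move=> x; rewrite !fmap1.
by move=> x y z g f; rewrite !fmapM.
Defined.

Lemma cat_iso_unfactorizable (obj obj' : Type) (C : category obj)
    (D : category obj') (F : functor C D) (G : functor D C) :
  cancel (fmor F) (fmor G) -> cancel (fmor G) (fmor F) ->
  forall (x y : obj) (f : C x y), unfactorizable f -> unfactorizable (fmap F f).
Proof.
move=> FK GK.
have reflF x y (f : C x y) : is_iso (fmap F f) -> is_iso f.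
  move=> /(is_iso_fmap G) fi.
  (* The arrows [fmap G (fmap F f)] and [f] have different types, so the property is transported
     along an equality in [mor]. *)
  exact: (eq_ind (fmor G (fmor F (Mor f))) (fun m => is_iso (arr m)) fi _
    (FK _)).
have reflG x y (f : D x y) : is_iso (fmap G f) -> is_iso f.
  move=> /(is_iso_fmap F) fi.
  exact: (eq_ind (fmor F (fmor G (Mor f))) (fun m => is_iso (arr m)) fi _
    (GK _)).
move=> x y f fu; split=> [/reflF|z g b e]; first exact: fu.1.
have {}e : Mor f = Mor (comp (fmap G g) (fmap G b)).
  by rewrite -(FK (Mor f)) /fmor /= e fmapM.
have [_] := eq_ind (Mor f) (fun m => unfactorizable (arr m)) fu _ e.
move=> /(_ _ _ _ erefl) [/reflG|/reflG]; auto.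
Qed.

Definition atomic (obj : Type) (C : category obj) (x y : obj) (f : C x y) :=
  is_iso f \/ unfactorizable f.

Section AtomicBijection.

Context (obj : Type) (C D : category obj) (F : forall x y, C x y -> D x y).
Hypothesis F1 : forall x, F (idm C x) = idm D x.
Hypothesis FM : forall x y z (g : C y z) (f : C x y),
  F (comp g f) = comp (F g) (F f).
Let FF : functor C D := @Functor obj obj C D id F F1 FM.
Hypothesis Fid : identity_on_iso_unfact FF.

Lemma atomic_fmap x y (f : C x y) : atomic f -> atomic (F f).
Proof.
have [_ [Fi _ _] [Fu _ _]] := Fid.
by case=> [fi|fu]; [left; exact: (Fi (Mor f))|right; exact: (Fu (Mor f))].
Qed.

(** Injectivity holds within each class; in the mixed cases the common image would be both
    invertible and unfactorizable. *)
Lemma atomic_inj x y (f g : C x y) :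
  atomic f -> atomic g -> F f = F g -> f = g.
Proof.
have [_ [Fi Ii _] [Fu Iu _]] := Fid.
move=> fa ga e; apply: Mor_inj; have {}e : fmor FF (Mor f) = fmor FF (Mor g).
  by rewrite /fmor /= e.
case: fa ga => [fi|fu] [gi|gu].
- by apply: Ii; rewrite ?inE.
- by have [] := Fu (Mor g) gu; rewrite -e; have := Fi (Mor f) fi.
- by have [] := Fu (Mor f) fu; rewrite e; have := Fi (Mor g) gi.
- by apply: Iu; rewrite ?inE.
Qed.

Lemma atomic_iso x y (f : C x y) : atomic f -> is_iso (F f) -> is_iso f.
Proof.
have [_ _ [Fu _ _]] := Fid.
by case=> // fu fi; have [] := Fu (Mor f) fu.
Qed.

Lemma atomic_unfact x y (f : C x y) :
  atomic f -> unfactorizable (F f) -> unfactorizable f.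
Proof.
have [_ [Fi _ _] _] := Fid.
by case=> // fi [[]]; exact: (Fi (Mor f)).
Qed.

Lemma atomic_surj x y (f : D x y) :
  atomic f -> exists2 g : C x y, atomic g & F g = f.
Proof.
have [_ [_ _ Si] [_ _ Su]] := Fid.
have lift (m : mor C) : atomic (arr m) -> fmor FF m = Mor f ->
    exists2 g : C x y, atomic g & F g = f.
  case: m => a b g /= ga e; have ea : a = x := congr1 (@dom _ _) e.
  have eb : b = y := congr1 (@cod _ _) e; subst a b.
  by exists g => //; apply: Mor_inj e.
case=> [/(Si (Mor f))|/(Su (Mor f))] [m ma e].
  by apply: lift e; left.
by apply: lift e; right.
Qed.

End AtomicBijection.

(** Each generator of [Q] goes to the unique atomic morphism of [C2] with the same image in [C]. *)
Lemma free_cover_lift (obj : Type) (C C1 C2 : category obj)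
    (F1 : functor C1 C) (F2 : functor C2 C) (Q : EIquiver) :
  cat_iso C1 (quiver_cat Q) ->
  identity_on_iso_unfact F1 -> identity_on_iso_unfact F2 ->
  exists G : functor C1 C2, fmor F2 \o fmor G =1 fmor F1.
Proof.
case: F1 F2 => o1 F1 F11 F1M [o2 F2 F21 F2M] [J [K [JK KJ JmK KmJ]]] Fid1 Fid2.
have e1 : o1 = id by apply/funext; case: Fid1.
have e2 : o2 = id by apply/funext; case: Fid2.
subst o1 o2.
have [phi phiP] : exists phi : forall x y (f : C1 x y), atomic f -> C2 x y,
    forall x y (f : C1 x y) (fa : atomic f),
      atomic (phi x y f fa) /\ F2 x y (phi x y f fa) = F1 x y f.
  pose E x y (f : C1 x y) fa := atomic_surj Fid2 (atomic_fmap Fid1 (f := f) fa).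
  exists (fun x y f fa => s2val (cid2 (E x y f fa))) => x y f fa.
  by case: cid2.
have grpA v (k : vgrp v) : atomic (fmap K (qgrp k : quiver_cat Q v v)).
  by left; apply: is_iso_fmap; apply: is_iso_endo.
have edgeA a (y : abiset (e := Q) a) : atomic (fmap K (qedge y)).
  by right; apply: (cat_iso_unfactorizable KmJ JmK); apply: unfactorizable_edge.
pose lg v k := phi _ _ _ (grpA v k).
pose le a y := phi _ _ _ (edgeA a y).
have lgF v k : F2 _ _ (lg v k) = F1 _ _ (fmap K (qgrp k : quiver_cat Q v v)).
  exact: (phiP _ _ _ _).2.
have leF a y : F2 _ _ (le a y) = F1 _ _ (fmap K (qedge y)).
  exact: (phiP _ _ _ _).2.
have isoA v k : is_iso (lg v k).
  apply: (atomic_iso Fid2); first exact: (phiP _ _ _ _).1.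
  rewrite lgF; apply: (is_iso_fmap (Functor F11 F1M)); apply: is_iso_fmap.
  exact: is_iso_endo.
have unfA a y : unfactorizable (le a y).
  apply: (atomic_unfact Fid2); first exact: (phiP _ _ _ _).1.
  have [_ _ [Fu _ _]] := Fid1.
  rewrite leF; apply: (Fu (Mor (fmap K (qedge y)))).
  by apply: (cat_iso_unfactorizable KmJ JmK); apply: unfactorizable_edge.
(* In this and the next three conditions both sides are atomic and agree after [F2], which is
   injective on atomic morphisms. *)
have lg1 v : lg v 1%g = idm C2 (K v).
  apply: (atomic_inj Fid2); [by left|by left; apply: is_iso_id|].
  by rewrite lgF F21 (fmap1 K v) F11.
have lgM v h k : lg v (h * k)%g = comp (lg v h) (lg v k).
  apply: (atomic_inj Fid2); [by left|by left; apply: is_iso_comp|].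
  by rewrite F2M !lgF -F1M -fmapM.
have lel a y h : le a (lact h y) = comp (lg _ h) (le a y).
  apply: (atomic_inj Fid2); [by right|by right; apply: unfactorizable_isol|].
  by rewrite F2M lgF !leF -F1M -fmapM.
have ler a y k : le a (ract y k) = comp (le a y) (lg _ k).
  apply: (atomic_inj Fid2); [by right|by right; apply: unfactorizable_isor|].
  by rewrite F2M lgF !leF -F1M -fmapM.
pose H := quiver_lift lg1 lgM lel ler.
have HF : forall v w (f : quiver_cat Q v w),
    F2 _ _ (fmap H f) = F1 _ _ (fmap K f).
  apply: quiver_ind => [v k|a y|u v w g f IHg IHf]; [exact: lgF|exact: leF|].
  by rewrite !fmapM F2M IHg IHf F1M.
exists (fcomp H J) => -[x y f] /=.
rewrite /fmor /= HF.
by have := congr1 (fmor (Functor F11 F1M)) (JmK (Mor f)).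
Qed.

(** For atomic [f], both [f] and [T f] are atomic with the same image in [C], hence equal; atomic
    morphisms generate. *)
Lemma cover_endo_id (obj : finType) (C C' : category obj) (F : functor C' C)
    (T : functor C' C') :
  (forall (x : obj) (f : C' x x), is_iso f) -> skeletal C ->
  identity_on_iso_unfact F -> fmor F \o fmor T =1 fmor F -> fmor T =1 id.
Proof.
move=> EI skel Fid FT; have Fo : F =1 id by case: Fid.
have To : T =1 id.
  by move=> x; have /(congr1 (@dom _ _)) := FT (Mor (idm C' x)); rewrite /= !Fo.
case: F Fid FT Fo => o F F1 FM Fid FT /funext; rewrite -/(@id obj) => /= eo.
subst o.
case: T To FT => t T T1 TM /funext; rewrite -/(@id obj) => /= et; subst t => FT.
have FTE x y (f : C' x y) : F _ _ (T _ _ f) = F _ _ f.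
  exact: Mor_inj (FT (Mor f)).
suff TE : forall x y (f : C' x y), T _ _ f = f.
  by move=> [x y f]; rewrite /fmor /= TE.
apply: (EI_ind EI) => [x y f fi|x y f fu|x y z g f Tg Tf].
- apply: (atomic_inj Fid); [left|by left|exact: FTE].
  exact: (is_iso_fmap (Functor T1 TM)).
(* That [T f] is unfactorizable is read off from its image, which equals that of [f]. *)
- apply: (atomic_inj Fid); [right|by right|exact: FTE].
  apply: (functor_unfactorizable (F := Functor F1 FM) EI skel) => //=.
  by rewrite FTE; have [_ _ [Fu _ _]] := Fid; exact: (Fu (Mor f)).
- by rewrite TM Tg Tf.
Qed.

Lemma free_cover_unique (obj : finType) (C C1 C2 : category obj) :
  skeletal C -> free_EI_cover C1 C -> free_EI_cover C2 C -> cat_iso C1 C2.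
Proof.
move=> skel [[EI1 [Q1 iso1]] [F1 [_ Fid1]]] [[EI2 [Q2 iso2]] [F2 [_ Fid2]]].
have [G GF] := free_cover_lift iso1 Fid1 Fid2.
have [H HF] := free_cover_lift iso2 Fid2 Fid1.
have HG : cancel (fmor G) (fmor H).
  apply: (cover_endo_id (T := fcomp H G) EI1.2 skel Fid1) => m.
  exact: etrans (HF (fmor G m)) (GF m).
have GH : cancel (fmor H) (fmor G).
  apply: (cover_endo_id (T := fcomp G H) EI2.2 skel Fid2) => m.
  exact: etrans (GF (fmor H m)) (HF m).
exists G, H; split=> // x.
  by have := congr1 (@dom _ _) (HG (Mor (idm C1 x))).
by have := congr1 (@dom _ _) (GH (Mor (idm C2 x))).
Qed.

Theorem proposition2p9 (obj : Type) (C : category obj) :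
  finite_EI C -> skeletal C -> connected C ->
  (exists C' : category obj, free_EI_cover C' C) /\
  (forall C1 C2 : category obj,
     free_EI_cover C1 C -> free_EI_cover C2 C -> cat_iso C1 C2).
Proof.
(* [T] is convertible to [obj], so [C] is already a category over a finite type. *)
move=> EI skel _; pose T := finite_carrier (finite_set_dom EI.1).
split; first exact: (@free_cover_exists T C EI skel).
by move=> C1 C2; exact: (@free_cover_unique T C C1 C2 skel).
Qed.
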